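(* Let $p_1\in[0,1]$ and let $PG_n$ be the random pentagonal chain network described in the context. Then for every $n\geq 1$, $$\mathbb{E}\big(S(PG_{n})\big)=(60-20p_{1})n^{3}+(60p_{1}+7)n^{2}-(40p_{1}+7)n.$$
   Context: Random chain network $PG_n$: $PG_1$ is a $5$-cycle (pentagon). For $n\ge 1$, $PG_{n+1}$ is obtained from $PG_n$ by adding a new pentagon $O_{n+1}$ with vertices $x_1,x_2,x_3,x_4,x_5$ in cyclic (clockwise) order and adding one edge joining $x_1$ to a vertex $u_n$ of $PG_n$. The vertex $u_1$ is any vertex of $PG_1$ (all are equivalent). For $n\ge 2$, $u_n$ is a vertex of the last pentagon $O_n$ (whose vertex $x_1$ is the one joined to $u_{n-1}$): with probability $p_1$ one takes $u_n\in\{x_2,x_5\}$ of $O_n$ (the two neighbours of $x_1$ in $O_n$), and with probability $p_2=1-p_1$ one takes $u_n\in\{x_3,x_4\}$ of $O_n$ (the two vertices at distance $2$ from $x_1$ in $O_n$); $p_1,p_2$ do not depend on the step. Thus $PG_n$ has $5n$ vertices. For a graph $G$, $d(v)$ denotes the degree of vertex $v$ and $d(u,v)$ the shortest-path distance. The Schultz index is $S(G)=\sum_{\{u,v\}\subseteq V_G} \big(d(u)+d(v)\big)\,d(u,v)$, the sum over unordered pairs of distinct vertices. *)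

(* Defs.v *)
From mathcomp Require Import all_boot all_order all_algebra.
Set Implicit Arguments. Unset Strict Implicit. Unset Printing Implicit Defensive.
Import Order.TTheory GRing.Theory Num.Theory.

Definition deg (T : finType) (e : rel T) (x : T) : nat := #|[set y | e x y]|.

Definition ball (T : finType) (e : rel T) (k : nat) (x : T) : {set T} :=
  iter k (fun S : {set T} => S :|: [set y | [exists z in S, e z y]]) [set x].

(* shortest-path distance: least k with y in ball e k x
   (graphs considered here are connected, so k < #|T|) *)
Definition dist (T : finType) (e : rel T) (x y : T) : nat :=
  find (fun k => y \in ball e k x) (iota 0 #|T|).

Definition schultz (N : nat) (e : rel 'I_N) : nat :=
  \sum_(u < N) \sum_(v < N | u < v) (deg e u + deg e v) * dist e u v.

(* Vertex 5k+j (j < 5) is vertex x_{j+1} of pentagon O_{k+1} (k >= 0).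
   Pentagon edges: j -- j+1 (mod 5).  Link edges: vertex a k of pentagon k
   is joined to vertex 0 (= x_1) of pentagon k+1. *)
Definition pent_adj (a : nat -> nat) (x y : nat) : bool :=
  let kx := x %/ 5 in let jx := x %% 5 in
  let ky := y %/ 5 in let jy := y %% 5 in
  [|| (kx == ky) && ((jy == jx.+1 %% 5) || (jx == jy.+1 %% 5)),
      (ky == kx.+1) && (jy == 0) && (jx == a kx)
    | (kx == ky.+1) && (jx == 0) && (jy == a ky)].

(* Choices: s i : 'I_4 is the choice made in pentagon O_{i+2} (0-indexed
   pentagon i+1), i < n-2; value c means vertex x_{c+2}, i.e. local index c+1.
   u_1 is (w.l.o.g.) vertex x_1 of O_1 (local index 0). *)
Definition attach (n : nat) (s : {ffun 'I_(n - 2) -> 'I_4}) (k : nat) : nat :=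
  if k is k'.+1 then
    (if @insub _ (fun m => m < n - 2) _ k' is Some i then (s i).+1 else 0)
  else 0.

Definition PG (n : nat) (s : {ffun 'I_(n - 2) -> 'I_4}) : rel 'I_(5 * n) :=
  fun u v => pent_adj (attach s) u v.

(* probability of a single choice: x_2 or x_5 (c = 0 or 3) each with p1/2,
   x_3 or x_4 (c = 1 or 2) each with p2/2 = (1-p1)/2. *)
Local Open Scope ring_scope.
Definition choice_prob (R : fieldType) (p1 : R) (c : 'I_4) : R :=
  if (c == 0 :> nat) || (c == 3 :> nat) then p1 / 2%:R else (1 - p1) / 2%:R.

Definition expected_schultz (R : fieldType) (p1 : R) (n : nat) : R :=
  \sum_(s : {ffun 'I_(n - 2) -> 'I_4})
     (\prod_(i < n - 2) choice_prob p1 (s i)) * (schultz (PG s))%:R.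

(* Main.v *)
Require Import Defs.
From mathcomp Require Import all_boot all_order all_algebra.
From mathcomp Require Import zify ring.
Import Order.TTheory GRing.Theory Num.Theory.

(** A shortest path from pentagon k to a later pentagon l leaves k at its
    attachment vertex, crosses every pentagon m strictly between them from x_1
    to its attachment vertex at the cost turn m, and enters l at x_1. Summing
    (d(u) + d(v)) d(u, v) over the 25 vertex pairs of the two pentagons
    therefore gives an expression that is affine in the numbers turn m, so its
    expectation is obtained by replacing turn m by its mean p1 + 2 (1 - p1) for
    the inner pentagons, and by 0 for the first and the last one. What remains
    is a polynomial sum over k < l. *)

(** * Recognising the distance function of a finite graph *)

Lemma mem_ball_S (T : finType) (e : rel T) k x y :
  (y \in ball e k.+1 x) =
  (y \in ball e k x) || [exists z in ball e k x, e z y].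
Proof. by rewrite /ball /= !inE. Qed.

(* Such an f is the distance from x: [ball e k x] is the sublevel set
   [f <= k], and f takes every value up to f y, hence f y < #|T|. *)
Lemma dist_unique (T : finType) (e : rel T) (x : T) (f : T -> nat) :
  f x = 0 -> (forall y, f y = 0 -> y = x) ->
  (forall z y, e z y -> f y <= (f z).+1) ->
  (forall y k, f y = k.+1 -> exists2 z, e z y & f z = k) ->
  forall y, dist e x y = f y.
Proof.
move=> fx f0 fS fP y.
have ballE k z : (z \in ball e k x) = (f z <= k).
  elim: k z => [|k IHk] z.
    rewrite /ball /= inE leqn0; apply/eqP/eqP => [->|/f0] //.
  rewrite mem_ball_S IHk; apply/idP/idP.
    case/orP=> [/leqW //|/existsP[w /andP[]]].
    by rewrite IHk => fw /fS fz; apply: leq_trans fz _.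
  rewrite leq_eqVlt ltnS => /orP[/eqP/fP[w ew fw]|->] //.
  by apply/orP; right; apply/existsP; exists w; rewrite IHk fw leqnn.
have attained k : k <= f y -> exists z, f z == k.
  move=> /subKn <-; elim: (f y - k) => [|m [z /eqP fz]].
    by exists y; rewrite subn0.
  case: (posnP (f y - m)) => [fym|fym].
    by exists z; rewrite fz subnS fym.
  have [w _ fw] : exists2 w, e w z & f w = (f y - m).-1.
    by apply: fP; rewrite fz prednK.
  by exists w; rewrite fw subnS.
have lt_fT : f y < #|T|.
  pose g (k : 'I_(f y).+1) := xchoose (attained k (ltn_ord k)).
  have g_inj : injective g.
    move=> i j gij; apply: val_inj => /=.
    by rewrite -(eqP (xchooseP (attained i (ltn_ord i)))) -/(g i) gij
               (eqP (xchooseP (attained j (ltn_ord j)))).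
  by have := leq_card g g_inj; rewrite card_ord.
have -> : dist e x y = find (fun k => f y <= k) (iota 0 #|T|).
  by apply: eq_find => k; apply: ballE.
(* The bound puts [f y] inside the search range; outside it, [find] would return the default
   [#|T|]. *)
have -> : iota 0 #|T| = iota 0 (f y) ++ f y :: iota (f y).+1 (#|T| - (f y).+1).
  by rewrite -[in LHS](subnKC lt_fT) addSnnS iotaD.
rewrite find_cat /= leqnn size_iota addn0 ifN //.
by apply/hasP => -[k]; rewrite mem_iota; lia.
Qed.

(** * Distances in the 5-cycle *)

Definition pent_dist (i j : nat) : nat :=
  minn ((i + 5 - j) %% 5) ((j + 5 - i) %% 5).

Definition cyc_adj (i j : nat) : bool := (j == i.+1 %% 5) || (i == j.+1 %% 5).

Lemma pent_dist_eq0 i j : i < 5 -> j < 5 -> (pent_dist i j == 0) = (i == j).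
Proof.
by case: i => [|[|[|[|[|i]]]]] //; case: j => [|[|[|[|[|j]]]]].
Qed.

Lemma pent_distxx i : pent_dist i i = 0.
Proof. by rewrite /pent_dist addnC addnK modnn. Qed.

Lemma pent_dist_lip b i j : b < 5 -> i < 5 -> j < 5 -> cyc_adj i j ->
  pent_dist b j <= (pent_dist b i).+1.
Proof.
case: b => [|[|[|[|[|b]]]]] //; case: i => [|[|[|[|[|i]]]]] //;
  by case: j => [|[|[|[|[|j]]]]].
Qed.

Lemma pent_dist_pred b j d : b < 5 -> j < 5 -> pent_dist b j = d.+1 ->
  exists i, [/\ i < 5, cyc_adj i j & pent_dist b i = d].
Proof.
move=> b5 j5 dE.
(* As a boolean search over five vertices, the existence claim is settled by computation for each
   [b] and [j]. *)
have: has (fun i => cyc_adj i j && (pent_dist b i == (pent_dist b j).-1))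
          (iota 0 5).
  move: b5 j5 dE; case: b => [|[|[|[|[|b]]]]] //;
  by case: j => [|[|[|[|[|j]]]]].
case/hasP=> i; rewrite mem_iota dE /= => i5 /andP[ij /eqP di].
by exists i.
Qed.

(** * Distances in a fixed chain of pentagons *)

(* Distance from the attachment vertex of pentagon k to x_1 of pentagon l,
   meaningful for k < l. *)
Definition gap (a : nat -> nat) (k l : nat) : nat :=
  (l - k) + \sum_(k.+1 <= m < l) pent_dist 0 (a m).

Definition chain_dist (a : nat -> nat) (x y : nat) : nat :=
  let k := x %/ 5 in let i := x %% 5 in
  let l := y %/ 5 in let j := y %% 5 in
  if k < l then pent_dist i (a k) + gap a k l + pent_dist 0 j
  else if l < k then pent_dist i 0 + gap a l k + pent_dist (a l) j
  else pent_dist i j.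

Lemma gapS a k : gap a k k.+1 = 1.
Proof. by rewrite /gap subSnn big_geq. Qed.

Lemma gap_recr a k l : k < l -> gap a k l.+1 = gap a k l + (pent_dist 0 (a l)).+1.
Proof. by move=> kl; rewrite /gap big_nat_recr //= subSn 1?ltnW //; lia. Qed.

Lemma gap_recl a k l : k.+1 < l ->
  gap a k l = gap a k.+1 l + (pent_dist 0 (a k.+1)).+1.
Proof. by move=> kl; rewrite /gap big_ltn //; lia. Qed.

Lemma gap_gt0 a k l : k < l -> 0 < gap a k l.
Proof. by rewrite /gap; lia. Qed.

Lemma pent_distC i j : pent_dist i j = pent_dist j i.
Proof. by rewrite /pent_dist minnC. Qed.

Lemma divmod5 k i : i < 5 -> (5 * k + i) %/ 5 = k /\ (5 * k + i) %% 5 = i.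
Proof. by move=> i5; split; lia. Qed.

Lemma pent_adjE a k i l j : i < 5 -> j < 5 ->
  pent_adj a (5 * k + i) (5 * l + j) =
  [|| (k == l) && cyc_adj i j, [&& l == k.+1, j == 0 & i == a k]
    | [&& k == l.+1, i == 0 & j == a l]].
Proof.
move=> i5 j5; rewrite /pent_adj.
by case: (divmod5 k i i5) (divmod5 l j j5) => [-> ->] [-> ->]; rewrite !andbA.
Qed.

Lemma chain_distE a k i l j : i < 5 -> j < 5 ->
  chain_dist a (5 * k + i) (5 * l + j) =
  if k < l then pent_dist i (a k) + gap a k l + pent_dist 0 j
  else if l < k then pent_dist i 0 + gap a l k + pent_dist (a l) j
  else pent_dist i j.
Proof.
move=> i5 j5; rewrite /chain_dist.
by case: (divmod5 k i i5) (divmod5 l j j5) => [-> ->] [-> ->].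
Qed.

(** Case analysis with this view writes a vertex as [5 * k + i], so that quotients and remainders by
    5 disappear. *)
Variant coord_spec : nat -> Type := Coord k i of i < 5 : coord_spec (5 * k + i).
Lemma coordP x : coord_spec x.
Proof.
have := Coord (x %/ 5) (x %% 5); rewrite mulnC -divn_eq; apply.
exact: ltn_pmod.
Qed.

Lemma coord_lt n k i : i < 5 -> (5 * k + i < 5 * n) = (k < n).
Proof. by move=> i5; lia. Qed.

Section Chain.
Variables (a : nat -> nat).
Hypothesis a5 : forall k, a k < 5.

Lemma chain_dist_refl x : chain_dist a x x = 0.
Proof.
by case: (coordP x) => k i i5; rewrite chain_distE // ltnn pent_distxx.
Qed.

Lemma chain_dist_eq0 x y : chain_dist a x y = 0 -> y = x.
Proof.
case: (coordP x) => k i i5; case: (coordP y) => l j j5.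
rewrite chain_distE //; case: (ltngtP k l) => [kl|lk|->].
- by have := gap_gt0 a k l kl; lia.
- by have := gap_gt0 a l k lk; lia.
by move/eqP; rewrite pent_dist_eq0 // => /eqP->.
Qed.

(** An edge inside a pentagon affects only the last cyclic distance, by at most one. By the
    recurrences for [gap], a link edge changes the total by exactly one, up when it leads away from
    [x] and down otherwise. *)
Lemma chain_dist_lip x z y : pent_adj a z y ->
  chain_dist a x y <= (chain_dist a x z).+1.
Proof.
case: (coordP x) => k i i5; case: (coordP y) => l j j5.
case: (coordP z) => m h h5; rewrite pent_adjE // !chain_distE //.
case/or3P=> [/andP[/eqP-> hj]|/and3P[/eqP-> /eqP-> /eqP->]
            |/and3P[/eqP-> /eqP-> /eqP->]].
- by case: (ltngtP k l) => _; rewrite ?addnS -?addnS ?leq_add2l pent_dist_lip.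
- case: (ltngtP k m) => [km|mk|->].
  + by rewrite ltnS (ltnW km) gap_recr // pent_distxx; lia.
  + rewrite ltnS (leqNgt k m) mk /= pent_distxx.
    (* If [m.+1 = k], the new vertex lies in the pentagon of [x], and the gap is the single link
       edge just crossed. *)
    have [mk1|mk1] := ltnP m.+1 k.
      by rewrite [gap a m k]gap_recl // [pent_dist (a m.+1) 0]pent_distC; lia.
    have -> : k = m.+1 by lia.
    by rewrite gapS; lia.
  + by rewrite ltnSn gapS pent_distxx; lia.
case: (ltngtP k l) => [kl|lk|->].
- by rewrite ltnS (ltnW kl) gap_recr // pent_distxx; lia.
- rewrite ltnS (leqNgt k l) lk /= pent_distxx.
  have [lk1|lk1] := ltnP l.+1 k.
    by rewrite [gap a l k]gap_recl // [pent_dist (a l.+1) 0]pent_distC; lia.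
  have -> : k = l.+1 by lia.
  by rewrite gapS; lia.
by rewrite ltnSn gapS pent_distxx; lia.
Qed.

(** Unless [y] is the vertex where the path enters its pentagon, step back inside that pentagon;
    otherwise step back over the link edge. The bound on [x] keeps pentagon [l.+1] in the chain when
    the path comes from a later pentagon. *)
Lemma chain_dist_pred n x y d : x < 5 * n -> y < 5 * n ->
  chain_dist a x y = d.+1 ->
  exists z, [/\ z < 5 * n, pent_adj a z y & chain_dist a x z = d].
Proof.
case: (coordP x) => k i i5; case: (coordP y) => l j j5.
rewrite !coord_lt // => kn ln; rewrite chain_distE //.
(* Here [b] is the entry vertex of the pentagon of [y], and [c] the length of the path up to [b]. *)
have inner b c : b < 5 -> j != b -> c + pent_dist b j = d.+1 ->
    exists h, [/\ h < 5, cyc_adj h j & c + pent_dist b h = d].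
  move=> b5 jb cd.
  have: pent_dist b j = (pent_dist b j).-1.+1.
    by move: (pent_dist_eq0 _ _ b5 j5); rewrite [b == j]eq_sym (negPf jb); lia.
  case/(pent_dist_pred _ _ _ b5 j5) => h [h5 hj dh].
  by exists h; split=> //; rewrite dh; move: (pent_dist_eq0 _ _ b5 j5);
    rewrite [b == j]eq_sym (negPf jb); lia.
case: (ltngtP k l) => [kl|lk|<-{l ln}].
- have [-> | j0] := eqVneq j 0.
    rewrite pent_distxx addn0; case: l kl ln => // l; rewrite ltnS => kl ln dE.
    exists (5 * l + a l); rewrite coord_lt // pent_adjE // chain_distE //.
    rewrite !eqxx /= orbT; split=> //; first lia.
    case: (ltngtP k l) kl dE => [kl _|//|-> _].
      by rewrite gap_recr //; lia.
    by rewrite gapS; lia.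
  case/(inner 0 _ isT j0) => h [h5 hj dh].
  by exists (5 * l + h); rewrite coord_lt // pent_adjE // chain_distE // kl eqxx hj.
- have [-> | ja] := eqVneq j (a l).
    rewrite pent_distxx addn0 => dE.
    exists (5 * l.+1 + 0); rewrite coord_lt // pent_adjE // chain_distE //.
    rewrite !eqxx /= !orbT; split=> //; first lia.
    case: (ltngtP l.+1 k) lk dE => [lk _|//|<- _].
      by rewrite [gap a l k]gap_recl // [pent_dist (a l.+1) 0]pent_distC; lia.
    by rewrite gapS; lia.
  case/(inner _ _ (a5 l) ja) => h [h5 hj dh].
  exists (5 * l + h); rewrite coord_lt // pent_adjE // chain_distE // eqxx hj.
  by rewrite (ltnNge k l) (ltnW lk) lk.
case/(pent_dist_pred _ _ _ i5 j5) => h [h5 hj dh].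
by exists (5 * k + h); rewrite coord_lt // pent_adjE // chain_distE // eqxx hj ltnn.
Qed.

Lemma dist_chain n (u v : 'I_(5 * n)) :
  dist (fun x y : 'I_(5 * n) => pent_adj a x y) u v = chain_dist a u v.
Proof.
apply: (dist_unique _ _ _ (fun y : 'I_(5 * n) => chain_dist a u y)).
- exact: chain_dist_refl.
- by move=> y yu; apply: val_inj; apply: chain_dist_eq0 yu.
- by move=> z y zy; apply: chain_dist_lip.
move=> y d /(chain_dist_pred n _ _ _ (ltn_ord u) (ltn_ord y)) [z [zn zy dz]].
by exists (Ordinal zn).
Qed.
End Chain.

(** * Degrees and Schultz index of a fixed chain *)

Lemma sum_coord n (F : nat -> nat) :
  \sum_(x < 5 * n) F x = \sum_(k < n) \sum_(i < 5) F (5 * k + i).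
Proof.
elim: n => [|n IHn]; first by rewrite muln0 !big_ord0.
by rewrite mulnSr big_split_ord [RHS]big_ord_recr /= -IHn.
Qed.

Lemma sum_ord_eq n k : \sum_(l < n) (l == k :> nat) = (k < n).
Proof.
by elim: n => [|n IHn]; rewrite ?big_ord0 // big_ord_recr /= IHn; lia.
Qed.

Lemma sum_ord_succ_eq n k : k < n -> \sum_(l < n) (l.+1 == k) = (0 < k).
Proof.
case: k => [|k] kn; first by rewrite big1.
by transitivity (\sum_(l < n) (l == k :> nat)); rewrite // sum_ord_eq (ltnW kn).
Qed.

Lemma sum_cyc_adj i : i < 5 -> \sum_(j < 5) (cyc_adj i j : nat) = 2.
Proof.
by case: i => [|[|[|[|[|i]]]]] // _; rewrite !big_ord_recl big_ord0.
Qed.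

Section Schultz.
Variables (a : nat -> nat) (n : nat).
Hypothesis a5 : forall k, a k < 5.

Definition chain_deg (k i : nat) : nat :=
  2 + (((i == 0) && (0 < k)) + ((k.+1 < n) && (i == a k))).

Lemma deg_chain k i (u : 'I_(5 * n)) : i < 5 -> nat_of_ord u = 5 * k + i ->
  deg (fun x y : 'I_(5 * n) => pent_adj a x y) u = chain_deg k i.
Proof.
move=> i5 uE.
have kn : k < n by have := ltn_ord u; rewrite uE coord_lt.
have -> : deg (fun x y : 'I_(5 * n) => pent_adj a x y) u =
    \sum_(y < 5 * n) (pent_adj a (5 * k + i) y : nat).
  rewrite /deg -sum1_card big_mkcond /=; apply: eq_bigr => y _.
  by rewrite inE uE; case: ifP.
rewrite (sum_coord n (fun y => pent_adj a (5 * k + i) y : nat)).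
(* The three disjuncts of [pent_adjE] force [l = k], [l = k.+1] and [l.+1 = k] respectively, so at
   most one holds and the disjunction becomes a sum. *)
have split3 l : \sum_(j < 5) (pent_adj a (5 * k + i) (5 * l + j) : nat) =
    (l == k) * 2 + ((l == k.+1) * (i == a k) + (l.+1 == k) * (i == 0)).
  transitivity (\sum_(j < 5) ((l == k) * cyc_adj i j +
      ((l == k.+1) * (i == a k) * (j == 0 :> nat) +
       (l.+1 == k) * (i == 0) * (j == a l :> nat)))).
    apply: eq_bigr => j _; rewrite pent_adjE // [k == l]eq_sym [k == l.+1]eq_sym.
    case: (eqVneq l k) => [->|_]; last first.
      case: (eqVneq l k.+1) => [->|_].
        have -> : (k.+2 == k) = false by lia.
        by case: (i == a k); case: (_ == 0).
      by case: (l.+1 == k); case: (i == 0); case: (_ == a l).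
    have -> : (k == k.+1) = false by lia.
    have -> : (k.+1 == k) = false by lia.
    by case: cyc_adj.
  rewrite !big_split /= -!big_distrr /= sum_cyc_adj // !sum_ord_eq a5.
  by rewrite !muln1.
under eq_bigr => l _ do rewrite split3.
rewrite !big_split /= -!big_distrl /= !sum_ord_eq sum_ord_succ_eq // kn.
by rewrite /chain_deg; case: (i == 0); case: (0 < k); case: (k.+1 < n); case: (i == a k).
Qed.

(* Also 0 at the first and the last pentagon, where [attach] is 0; this keeps
   the formula for [cross_schultz] free of case distinctions. *)
Definition turn (k : nat) : nat := pent_dist 0 (a k).
Definition pent_deg (k : nat) : nat := 10 + ((0 < k) + (k.+1 < n)).
(** Each vertex has total distance 6 to the other four, so every unit of degree in the pentagon
    counts 6 times. *)
Definition inner_schultz (k : nat) : nat := 60 + 6 * ((0 < k) + (k.+1 < n)).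
Definition cross_schultz (k l : nat) : nat :=
  120 + 5 * (turn k + turn l)
  + (6 + 5 * gap a k l) * (pent_deg k + pent_deg l).

Definition pair_schultz (x y : nat) : nat :=
  (chain_deg (x %/ 5) (x %% 5) + chain_deg (y %/ 5) (y %% 5)) *
  chain_dist a x y.

Lemma pair_schultzE k i l j : i < 5 -> j < 5 ->
  pair_schultz (5 * k + i) (5 * l + j) =
  (chain_deg k i + chain_deg l j) * chain_dist a (5 * k + i) (5 * l + j).
Proof.
move=> i5 j5; rewrite /pair_schultz.
by case: (divmod5 k i i5) (divmod5 l j j5) => [-> ->] [-> ->].
Qed.

Lemma sum_inner k :
  \sum_(i < 5) \sum_(j < 5) (i < j) * pair_schultz (5 * k + i) (5 * k + j)
  = inner_schultz k.
Proof.
under eq_bigr => i _ do under eq_bigr => j _ do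
  rewrite pair_schultzE // chain_distE // ltnn /chain_deg.
rewrite /inner_schultz; move: (a k) (a5 k) (0 < k) (k.+1 < n) => ak.
case: ak => [|[|[|[|[|ak]]]]] // _ [] [];
  by rewrite !big_ord_recl !big_ord0.
Qed.

Lemma sum_cross k l : a 0 = 0 -> a n.-1 = 0 -> k < l -> l < n ->
  \sum_(i < 5) \sum_(j < 5) pair_schultz (5 * k + i) (5 * l + j)
  = cross_schultz k l.
Proof.
move=> a0 an kl ln.
transitivity (\sum_(i < 5) \sum_(j < 5) (chain_deg k i + chain_deg l j) *
   (pent_dist i (a k) + gap a k l + pent_dist 0 j)).
  apply: eq_bigr => i _; apply: eq_bigr => j _.
  by rewrite pair_schultzE // chain_distE // kl.
have kn : k.+1 < n by apply: leq_ltn_trans ln.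
have sumD m : m < n -> \sum_(i < 5) chain_deg m i = pent_deg m.
  move=> mn; rewrite !big_ord_recl big_ord0 /chain_deg /pent_deg /=.
  move: (a m) (a5 m) (0 < m) (m.+1 < n) => am.
  by case: am => [|[|[|[|[|am]]]]] // _ [] [].
(* Degree 2 everywhere gives [2 * 6]. The link at x_1 adds its distance [turn k] to [a k], and the
   link at [a k] adds 0. The first pentagon has no link at x_1, which agrees because [a 0 = 0]. The
   mirror argument at [l] uses [a n.-1 = 0]. *)
have sumA : \sum_(i < 5) chain_deg k i * pent_dist i (a k) = 12 + turn k.
  rewrite !big_ord_recl big_ord0 /chain_deg /turn kn /=.
  case: (posnP k) => [->|_]; first by rewrite a0.
  by move: (a k) (a5 k); case=> [|[|[|[|[|am]]]]].
have sumB : \sum_(j < 5) chain_deg l j * pent_dist 0 j = 12 + turn l.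
  rewrite !big_ord_recl big_ord0 /chain_deg /turn (leq_ltn_trans _ kl) //=.
  have [lN|lN] := ltnP l.+1 n; last first.
    have -> : l = n.-1 by lia.
    by rewrite an.
  by move: (a l) (a5 l); case=> [|[|[|[|[|am]]]]].
have sumP b : b < 5 -> \sum_(j < 5) pent_dist j b = 6.
  by case: b => [|[|[|[|[|b]]]]] // _; rewrite !big_ord_recl big_ord0.
have sumP0 : \sum_(j < 5) pent_dist 0 j = 6 by rewrite !big_ord_recl big_ord0.
rewrite /cross_schultz; move: (gap a k l) => g.
have -> : \sum_(i < 5) \sum_(j < 5) (chain_deg k i + chain_deg l j) *
   (pent_dist i (a k) + g + pent_dist 0 j) =
   5 * (\sum_(i < 5) chain_deg k i * pent_dist i (a k)) +
   (5 * g + \sum_(j < 5) pent_dist 0 j) * (\sum_(i < 5) chain_deg k i) +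
   ((\sum_(i < 5) pent_dist i (a k)) + 5 * g) * (\sum_(j < 5) chain_deg l j) +
   5 * (\sum_(j < 5) chain_deg l j * pent_dist 0 j).
  rewrite !big_ord_recl !big_ord0; ring.
rewrite sumA sumB sumP // sumP0 !sumD //; last by apply: ltnW.
ring.
Qed.

Lemma schultz_chain : a 0 = 0 -> a n.-1 = 0 ->
  schultz (fun x y : 'I_(5 * n) => pent_adj a x y) =
  \sum_(l < n) (inner_schultz l + \sum_(k < l) cross_schultz k l).
Proof.
move=> a0 an.
pose H x y := (x < y) * pair_schultz x y.
transitivity (\sum_(u < 5 * n) \sum_(v < 5 * n) H u v).
  apply: eq_bigr => u _; rewrite big_mkcond /=; apply: eq_bigr => v _.
  rewrite /H; case: ifP; rewrite ?mul0n // mul1n => _.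
  rewrite dist_chain // /pair_schultz.
  rewrite (deg_chain (u %/ 5) (u %% 5)) ?ltn_pmod //
    ?(deg_chain (v %/ 5) (v %% 5)) ?ltn_pmod //;
  by rewrite [RHS]addnC [5 * (_ %/ _)]mulnC addnC -divn_eq.
rewrite (sum_coord n (fun u => \sum_(v < 5 * n) H u v)).
under eq_bigr => k _ do under eq_bigr => i _ do
  rewrite (sum_coord n (fun v => H (5 * k + i) v)).
under eq_bigr => k _ do rewrite exchange_big /=.
rewrite exchange_big /=; apply: eq_bigr => l _.
(* Now [l] is the pentagon of the larger vertex: [x < y] is automatic for [k < l] and impossible for
   [k > l], which leaves only [k = l] in the complement. *)
rewrite (bigID (fun k : 'I_n => k < l)) /= addnC; congr (_ + _).
  rewrite (bigD1 l) ?ltnn //= [X in _ + X]big1 ?addn0.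
    rewrite -sum_inner; apply: eq_bigr => i _; apply: eq_bigr => j _.
    by rewrite /H ltn_add2l.
  move=> k; rewrite -val_eqE /= => kl; rewrite big1 // => i _; rewrite big1 // => j _.
  by rewrite /H; have := ltn_ord i; have := ltn_ord j; case: ltnP => //; lia.
rewrite (big_ord_widen_cond n xpredT (fun k => cross_schultz k l)
           (ltnW (ltn_ord l))) /=.
apply: eq_bigr => k kl; rewrite -sum_cross //.
apply: eq_bigr => i _; apply: eq_bigr => j _.
by rewrite /H; have := ltn_ord i; have := ltn_ord j; case: ltnP; rewrite ?mul1n //; lia.
Qed.
End Schultz.

(** * Finite means and product weights *)

Section Mean.
Local Open Scope ring_scope.
Variables (R : comNzRingType) (S : finType) (P : S -> R).
Hypothesis P1 : \sum_s P s = 1.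

Definition mean (X : S -> R) : R := \sum_s P s * X s.

Lemma mean_cst c : mean (fun=> c) = c.
Proof. by rewrite /mean -big_distrl /= P1 mul1r. Qed.

Lemma meanD X Y : mean (fun s => X s + Y s) = mean X + mean Y.
Proof. by rewrite /mean -big_split; apply: eq_bigr => s _; rewrite mulrDr. Qed.

Lemma meanZ X c : mean (fun s => c * X s) = c * mean X.
Proof. by rewrite /mean big_distrr; apply: eq_bigr => s _; rewrite mulrCA. Qed.

Lemma mean_sum I (r : seq I) (Q : pred I) (X : I -> S -> R) :
  mean (fun s => \sum_(i <- r | Q i) X i s) = \sum_(i <- r | Q i) mean (X i).
Proof.
rewrite /mean exchange_big /=; apply: eq_bigr => s _.
by rewrite big_distrr.
Qed.

Lemma eq_mean X Y : X =1 Y -> mean X = mean Y.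
Proof. by move=> XY; apply: eq_bigr => s _; rewrite XY. Qed.
End Mean.

Section ProductMeasure.
Local Open Scope ring_scope.
Variables (R : comNzRingType) (I T : finType) (w : T -> R).
Hypothesis w1 : \sum_t w t = 1.

Definition prod_weight (s : {ffun I -> T}) : R := \prod_i w (s i).

Lemma sum_prod_weight : \sum_s prod_weight s = 1.
Proof.
rewrite /prod_weight -(bigA_distr_bigA (fun _ t => w t)).
by rewrite big1.
Qed.

(** Absorb [g] into the factor at [i0]; distributivity turns the sum over functions into a product
    of sums, all equal to 1 except the one at [i0]. *)
Lemma mean_coord (g : T -> R) (i0 : I) :
  mean R {ffun I -> T} prod_weight (fun s => g (s i0)) = \sum_t w t * g t.
Proof.
pose F i t := w t * (if i == i0 then g t else 1).
transitivity (\sum_(s : {ffun I -> T}) \prod_i F i (s i)).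
  apply: eq_bigr => s _; rewrite /prod_weight /F big_split /=; congr (_ * _).
  by rewrite -big_mkcond big_pred1_eq.
rewrite -bigA_distr_bigA (bigD1 i0) //= [X in _ * X]big1 ?mulr1.
  by apply: eq_bigr => t _; rewrite /F eqxx.
by move=> i /negPf ii0; rewrite -[RHS]w1; apply: eq_bigr => t _; rewrite /F ii0 mulr1.
Qed.
End ProductMeasure.

(** * The random chain and its expected Schultz index *)

Section Attach.
Variables (n : nat) (s : {ffun 'I_(n - 2) -> 'I_4}).

Lemma attach_lt5 k : attach s k < 5.
Proof. by case: k => //= k; case: insubP => // i _ _; rewrite ltnS. Qed.

(** For [n >= 2], the index lies one past the last choice, so [insub] fails and the default 0 is
    returned. *)
Lemma attach_last : attach s n.-1 = 0.
Proof. by case: n s => [|[|m]] // s' /=; rewrite insubF //; lia. Qed.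

Lemma attach_inner k (kn : k < n - 2) : attach s k.+1 = (s (Ordinal kn)).+1.
Proof. by rewrite /= insubT. Qed.
End Attach.

Section Expected.
Local Open Scope ring_scope.
Variables (R : realFieldType) (p1 : R).

Lemma sum_choice_prob : \sum_c choice_prob p1 c = 1.
Proof. by rewrite !big_ord_recl big_ord0 /choice_prob /=; field. Qed.

Notation meanPG n := (mean R _ (prod_weight R 'I_(n - 2) 'I_4 (choice_prob p1))).
Notation turnR s k := ((turn (attach s) k)%:R : R).

Definition mean_turn (n k : nat) : R :=
  (2 - p1) * ((0 < k)%N && (k.+1 < n)%N)%:R.

Lemma mean_turnE n k : (k < n)%N ->
  meanPG n (fun s => turnR s k) = mean_turn n k.
Proof.
have mc := mean_cst _ _ _ (sum_prod_weight _ 'I_(n - 2) _ _ sum_choice_prob).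
rewrite /mean_turn /turn; case: k => [|k] kn.
  by rewrite mulr0 -[RHS]mc; apply: eq_mean => s.
have [kn2|kn2] := ltnP k (n - 2); last first.
  have -> : (k.+2 < n)%N = false by lia.
  have kE : k.+1 = n.-1 by lia.
  by rewrite mulr0 -[RHS]mc; apply: eq_mean => s; rewrite kE attach_last.
have -> : (k.+2 < n)%N by lia.
transitivity (meanPG n (fun s => (pent_dist 0 (s (Ordinal kn2)).+1)%:R : R)).
  by apply: eq_mean => s; rewrite attach_inner.
rewrite (mean_coord _ _ _ _ sum_choice_prob (fun c => (pent_dist 0 c.+1)%:R)).
(* The four choices have turns 1, 2, 2, 1; the outer two have total weight [p1], the inner two
   [1 - p1]. *)
rewrite !big_ord_recl big_ord0 /choice_prob /=.
rewrite /bump /= -[pent_dist 0 1]/1%N -[pent_dist 0 2]/2%N.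
by rewrite -[pent_dist 0 3]/2%N -[pent_dist 0 4]/1%N; field.
Qed.

Definition degR (n k : nat) : R := (pent_deg n k)%:R.
Definition mean_cross (n k l : nat) : R :=
  120 + 5 * (mean_turn n k + mean_turn n l)
  + (degR n k + degR n l) *
    (6 + 5 * ((l - k)%N%:R + \sum_(k.+1 <= m < l) mean_turn n m)).

(** In [cross_schultz] the gap is multiplied only by degree sums, which do not depend on the
    choices, so linearity of the mean suffices. *)
Lemma expected_schultzE n :
  expected_schultz p1 n =
  \sum_(l < n) ((inner_schultz n l)%:R + \sum_(k < l) mean_cross n k l).
Proof.
have mc := mean_cst _ _ _ (sum_prod_weight _ 'I_(n - 2) _ _ sum_choice_prob).
transitivity (meanPG n (fun s => \sum_(l < n) ((inner_schultz n l)%:R +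
   \sum_(k < l) (120 + 5 * (turnR s k + turnR s l) + (degR n k + degR n l) *
    (6 + 5 * ((l - k)%N%:R + \sum_(k.+1 <= m < l) turnR s m)))))).
  apply: eq_mean => s.
  have := schultz_chain (attach s) n (attach_lt5 n s) erefl (attach_last n s).
  rewrite -/(PG s) => ->.
  rewrite natr_sum; apply: eq_bigr => l _.
  rewrite natrD natr_sum; congr (_ + _); apply: eq_bigr => k _.
  rewrite /cross_schultz /gap /degR.
  by move: (pent_deg n k) (pent_deg n l) => dk dl; 
  by rewrite !(natrD, natrM) natr_sum [X in _ + X]mulrC.
rewrite mean_sum; apply: eq_bigr => l _.
rewrite meanD mc mean_sum; congr (_ + _); apply: eq_bigr => k _.
have kn : (k < n)%N by apply: ltn_trans (ltn_ord l).
rewrite !(meanD, meanZ, mc) mean_sum !mean_turnE //.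
rewrite /mean_cross; congr (_ + _ * (_ + _ * (_ + _))).
rewrite big_nat [RHS]big_nat; apply: eq_bigr => m /andP[_ ml].
by rewrite mean_turnE //; apply: ltn_trans ml _.
Qed.

(** * Evaluation of the polynomial sums *)

Lemma mean_crossE n k l : (k < l)%N -> (l < n.+1)%N ->
  mean_cross n.+1 k l =
  120 + 5 * (2 - p1) * (2 - (k == 0)%:R - (l == n)%:R)
  + (24 - (k == 0)%:R - (l == n)%:R) *
    (6 + 5 * ((l%:R - k%:R) + (l%:R - k%:R - 1) * (2 - p1))).
Proof.
move=> kl ln; rewrite /mean_cross.
have -> : \sum_(k.+1 <= m < l) mean_turn n.+1 m = (l%:R - k%:R - 1) * (2 - p1).
  rewrite big_nat (eq_bigr (fun=> 2 - p1)); last first.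
    move=> m /andP[km ml]; rewrite /mean_turn.
    have -> : (0 < m)%N by lia.
    have -> : (m.+1 < n.+1)%N by lia.
    by rewrite mulr1.
  by rewrite -big_nat sumr_const_nat -[LHS]mulr_natl natrB // -natr1; ring.
(* As [k < l <= n], pentagon [k] can be an end only at 0 and [l] only at [n], so two indicators
   record all boundary effects. *)
rewrite natrB 1?ltnW // /mean_turn /degR /pent_deg !natrD.
have -> : (0 < k)%N%:R = 1 - (k == 0)%:R :> R.
  by case: k kl => [|k] _; rewrite ?subr0 ?subrr.
have -> : (k.+1 < n.+1)%N by lia.
have -> : (0 < l)%N by lia.
have -> : (l.+1 < n.+1)%N%:R = 1 - (l == n)%:R :> R.
  rewrite ltnS in ln; rewrite ltnS eqn_leq ln /= [(n <= l)%N]leqNgt.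
  by case: (l < n)%N; rewrite /= ?subr0 ?subrr.
rewrite andbT; case: (k) kl => [|k'] _ /=; ring.
Qed.

(* Mean contribution of the pairs whose later pentagon is number l > 0; y is the
   indicator of l being the last pentagon. *)
Definition mean_level (l y : R) : R :=
  72 - 6 * y + l * (120 + 5 * (2 - p1) * (2 - y)) - 5 * (2 - p1)
  + (24 - y) * (l * (6 + 5 * l + 5 * (l - 1) * (2 - p1))
                - 5 * (3 - p1) * (l * (l - 1)) / 2)
  - (6 + 5 * l + 5 * (l - 1) * (2 - p1)).

Lemma mean_levelE n l : (0 < l)%N -> (l < n.+1)%N ->
  (inner_schultz n.+1 l)%:R + \sum_(k < l) mean_cross n.+1 k l =
  mean_level l%:R (l == n)%:R.
Proof.
move=> l0 ln.
have -> : (inner_schultz n.+1 l)%:R = 72 - 6 * (l == n)%:R :> R.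
  rewrite /inner_schultz l0 ltnS.
  have -> : (l < n)%N = ~~ (l == n) by lia.
  by case: (l == n); rewrite /= -?natrD; ring.
rewrite (eq_bigr (fun k : 'I_l =>
    (fun k : nat => 120 + 5 * (2 - p1) * (2 - (k == 0)%:R - (l == n)%:R)
     + (24 - (k == 0)%:R - (l == n)%:R) *
    (6 + 5 * ((l%:R - k%:R) + (l%:R - k%:R - 1) * (2 - p1)))) k)); last first.
  by move=> k _; rewrite mean_crossE.
move: (_ == n)%:R => y; rewrite /mean_level.
case: l l0 {ln} => // l _;
(* The summand itself involves [l]; freezing it as [L] lets the induction run on the number of terms
   alone. *)
have sumE (L : R) m : \sum_(k < m.+1) (120 + 5 * (2 - p1) * (2 - (k == 0 :> nat)%:R - y)
     + (24 - (k == 0 :> nat)%:R - y) *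
    (6 + 5 * ((L - k%:R) + (L - k%:R - 1) * (2 - p1)))) =
   m.+1%:R * (120 + 5 * (2 - p1) * (2 - y)) - 5 * (2 - p1)
  + (24 - y) * (m.+1%:R * (6 + 5 * L + 5 * (L - 1) * (2 - p1))
                - 5 * (3 - p1) * (m.+1%:R * (m.+1%:R - 1)) / 2)
  - (6 + 5 * L + 5 * (L - 1) * (2 - p1)).
  elim: m => [|m IHm]; first by rewrite big_ord1 /=; field.
  by rewrite big_ord_recr IHm /= -[m.+2%:R]natr1 -[m.+1%:R]natr1; field.
by rewrite sumE; ring.
Qed.

(** The chain has [N.+2] pentagons. The first has one link, hence 66, and no earlier pentagon to
    pair with. *)
Lemma sum_mean_level N :
  66 + \sum_(i < N) mean_level i.+1%:R 0 + mean_level N.+1%:R 1 =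
  (60 - 20 * p1) * N.+2%:R ^+ 3 + (60 * p1 + 7) * N.+2%:R ^+ 2
    - (40 * p1 + 7) * N.+2%:R.
Proof.
elim: N => [|N IHN]; first by rewrite big_ord0 /mean_level; field.
rewrite big_ord_recr /=.
(* Lengthening the chain turns the former last level into an inner one, so the hypothesis is first
   solved for the sum of the inner levels. *)
have -> : \sum_(i < N) mean_level i.+1%:R 0 =
   (60 - 20 * p1) * N.+2%:R ^+ 3 + (60 * p1 + 7) * N.+2%:R ^+ 2
    - (40 * p1 + 7) * N.+2%:R - 66 - mean_level N.+1%:R 1.
  by rewrite -IHN; ring.
by rewrite /mean_level -[N.+3%:R]natr1 -[N.+2%:R]natr1 -[N.+1%:R]natr1; field.
Qed.
End Expected.

Local Open Scope ring_scope.

Theorem theorem2p2 (R : realFieldType) (p1 : R) (n : nat) :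
  0 <= p1 <= 1 -> (1 <= n)%N ->
  expected_schultz p1 n =
    (60 - 20 * p1) * n%:R ^+ 3 + (60 * p1 + 7) * n%:R ^+ 2
    - (40 * p1 + 7) * n%:R.
Proof.
move=> _ n_gt0; rewrite expected_schultzE.
(* A single pentagon is both first and last and has no link, so it is treated separately. *)
case: n n_gt0 => [//|[|N]] _.
  by rewrite big_ord1 big_ord0 /inner_schultz /=; ring.
rewrite -sum_mean_level big_ord_recl big_ord_recr /= -[RHS]addrA.
congr +%R; first by rewrite big_ord0 addr0.
congr +%R; last by rewrite mean_levelE // eqxx.
apply: eq_bigr => i _; rewrite mean_levelE // ?ltnS 1?ltnW //.
by rewrite eqSS (ltn_eqF (ltn_ord i)).
Qed.
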